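(* Let $k\in\mathcal{K}_E$ and assume that $\mathbb{E}[\sqrt{k(\mathbf{G},\mathbf{G})}]<\infty$ for all $\mathbf{G}\sim F$ and all $F\in\mathcal{F}$. Then, for $\emptyset\ne u\subseteq\{1,\ldots,d\}$, $k$ is an equivalent kernel for the independence test between $\mathbf{X}_u$ and $g(\mathbf{X}_u,\mathbf{Z})$; that is, with $(\mathbf{X}_u',\mathbf{Z}')$ an i.i.d. copy of $(\mathbf{X}_u,\mathbf{Z})$, $$\mathbb{E}\left[k\left(g^{tot}_u(\mathbf{X}_u,\mathbf{Z}),\,g^{tot}_u(\mathbf{X}_u',\mathbf{Z}')\right)\right]-k(\mathbf{0},\mathbf{0})=0\ \Longrightarrow\ g^{tot}_u(\mathbf{X}_u,\mathbf{Z})=\mathbf{0}\ \text{a.s.}$$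
   Context: Setting. $f:\mathbb{R}^d\to\mathbb{R}^n$ is a function and $\mathbf{X}=(X_1,\ldots,X_d)$ a random vector. For $\emptyset\ne u\subseteq\{1,\ldots,d\}$, $\mathbf{X}_u:=(X_j)_{j\in u}$, $\mathbf{X}_{\sim u}:=(X_j)_{j\notin u}$. The dependency model is $\mathbf{X}_{\sim u}\stackrel{d}{=}r_u(\mathbf{X}_u,\mathbf{Z})$, with $r_u$ a function, $\mathbf{Z}$ a vector of $d-|u|$ independent variables, and $\mathbf{X}_u$ independent of $\mathbf{Z}$; $g(\mathbf{X}_u,\mathbf{Z}):=f(\mathbf{X}_u,r_u(\mathbf{X}_u,\mathbf{Z}))\stackrel{d}{=}f(\mathbf{X})$ ($r_u,\mathbf{Z},g$ depend on $u$). The first-order and total ANOVA functionals (AFs) of $\mathbf{X}_u$ are $g^{fo}_u(\mathbf{X}_u):=\mathbb{E}_{\mathbf{Z}}[g(\mathbf{X}_u,\mathbf{Z})]-\mathbb{E}[g(\mathbf{X}_u,\mathbf{Z})]$ and $g^{tot}_u(\mathbf{X}_u,\mathbf{Z}):=g(\mathbf{X}_u,\mathbf{Z})-\mathbb{E}_{\mathbf{X}_u}[g(\mathbf{X}_u,\mathbf{Z})]$ (expectations assumed to exist). $\mathcal{F}$ is the set of Borel probability distributions $F$ on $\mathbb{R}^n$ such that $g^{tot}_u(\mathbf{X}_u,\mathbf{Z})\sim F$ or $g^{fo}_u(\mathbf{X}_u)\sim F$ for some $u\subseteq\{1,\ldots,d\}$. Kernels. $\mathcal{K}$ is the set of valid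 measurable kernels $k:\mathbb{R}^n\times\mathbb{R}^n\to\mathbb{R}$, i.e. $k(r,r')=\langle\phi(r),\phi(r')\rangle$ for some map $\phi$ into a Hilbert space. $k$ is centered at $\mathbf{0}$ if $k(\cdot,\mathbf{0})=0$. $H$ denotes the CDF of the Dirac measure $\delta_{\mathbf{0}}$. $\mathcal{K}_E$ is the set of $k\in\mathcal{K}$ satisfying at least one of: (a) $k$ is centered at $\mathbf{0}$ and, for all $F\in\mathcal{F}$, $\mathbb{E}_{\mathbf{G}\sim F,\mathbf{G}'\sim F}[k(\mathbf{G},\mathbf{G}')]=0\Rightarrow F=H$ ($\mathbf{G},\mathbf{G}'$ independent); (b) for all signed measures $\nu=F\otimes F-H\otimes H$ with $F\in\mathcal{F}$, $\int k\,d\nu=0\Rightarrow\nu=0$. *)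

(* Defs.v *)
From HB Require Import structures.
From mathcomp Require Import all_boot all_order all_algebra.
From mathcomp Require Import sesquilinear.
From mathcomp Require Import all_classical all_reals all_analysis.

Set Implicit Arguments.
Unset Strict Implicit.
Unset Printing Implicit Defensive.

Import Order.TTheory GRing.Theory Num.Theory.
Import numFieldNormedType.Exports.

Local Open Scope classical_set_scope.
Local Open Scope ring_scope.

(* R^m is m.-tuple R, which carries the product (i.e. Borel) sigma-algebra. *)
Definition zerov (R : realType) (m : nat) : m.-tuple R := [tuple 0 | i < m].

Definition subvec (R : realType) (d : nat) (u : {set 'I_d}) (x : d.-tuple R) :
    #|u|.-tuple R :=
  [tuple tnth x (enum_val i) | i < #|u|].

(* The vector of R^d whose u-part is x and whose ~u-part is y. *)
Definition join_vec (R : realType) (d : nat) (u : {set 'I_d})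
    (x : #|u|.-tuple R) (y : #|~: u|.-tuple R) : d.-tuple R :=
  [tuple if j \in u then nth 0 x (index j (enum u))
         else nth 0 y (index j (enum (~: u))) | j < d].

Lemma join_subvec (R : realType) (d : nat) (u : {set 'I_d}) (x : d.-tuple R) :
  join_vec (subvec u x) (subvec (~: u) x) = x.
Proof.
have H (A : {set 'I_d}) j : j \in A ->
    nth 0 (subvec A x) (index j (enum A)) = tnth x j.
  move=> jA; have lt : (index j (enum A) < #|A|)%N.
    by rewrite cardE index_mem mem_enum.
  rewrite -[index _ _]/(val (Ordinal lt)) -tnth_nth tnth_mktuple.
  by rewrite (enum_val_nth j) /= nth_index ?mem_enum.
apply: eq_from_tnth => j; rewrite tnth_mktuple.
by case: ifPn => ju; apply: H; rewrite ?inE.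
Qed.

Lemma subvec_joinl (R : realType) (d : nat) (u : {set 'I_d})
    (x : #|u|.-tuple R) (y : #|~: u|.-tuple R) : subvec u (join_vec x y) = x.
Proof.
apply: eq_from_tnth => i; rewrite !tnth_mktuple enum_valP.
rewrite (enum_val_nth (enum_val i)) index_uniq ?enum_uniq -?cardE//.
by rewrite -tnth_nth.
Qed.

Lemma subvec_joinr (R : realType) (d : nat) (u : {set 'I_d})
    (x : #|u|.-tuple R) (y : #|~: u|.-tuple R) :
  subvec (~: u) (join_vec x y) = y.
Proof.
apply: eq_from_tnth => i; rewrite !tnth_mktuple.
have := enum_valP i; rewrite inE => /negbTE ->.
rewrite (enum_val_nth (enum_val i)) index_uniq ?enum_uniq -?cardE//.
by rewrite -tnth_nth.
Qed.

Section random_vectors.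
Context {d1 d2 dE dE' : measure_display} {R : realType}.
Context {T1 : measurableType d1} {T2 : measurableType d2}.
Context {E : measurableType dE} {E' : measurableType dE'}.

Definition same_law (P1 : probability T1 R) (Y1 : T1 -> E)
    (P2 : probability T2 R) (Y2 : T2 -> E) : Prop :=
  forall A, measurable A -> P1 (Y1 @^-1` A) = P2 (Y2 @^-1` A).

Definition has_law (P : probability T1 R) (Y : T1 -> E)
    (F : probability E R) : Prop :=
  measurable_fun setT Y /\
  forall A, measurable A -> P (Y @^-1` A) = F A.

Definition independent2 (P : probability T1 R) (Y : T1 -> E) (Y' : T1 -> E') :
    Prop :=
  forall A B, measurable A -> measurable B ->
    P (Y @^-1` A `&` Y' @^-1` B) = (P (Y @^-1` A) * P (Y' @^-1` B))%E.

(* The product rule over subfamilies is the case where some A i are setT. *)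
Definition independent_components (P : probability T1 R) (m : nat)
    (Z : T1 -> m.-tuple R) : Prop :=
  forall A : 'I_m -> set R, (forall i, measurable (A i)) ->
    P (\bigcap_(i in setT) [set w | A i (tnth (Z w) i)])
    = (\prod_(i < m) P [set w | A i (tnth (Z w) i)])%E.

End random_vectors.

(* V1 and V2 are i.i.d. with the law of V.  They may live on another
   probability space, since the one carrying V need not carry an independent
   copy of V. *)
Definition iid_copies (d1 d2 dE : measure_display) (R : realType)
    (T1 : measurableType d1) (T2 : measurableType d2) (E : measurableType dE)
    (P1 : probability T1 R) (V : T1 -> E)
    (P2 : probability T2 R) (V1 V2 : {RV P2 >-> E}) : Prop :=
  [/\ same_law P1 V P2 V1, same_law P1 V P2 V2 & independent2 P2 V1 V2].

Section anova.
Context (dT : measure_display) (R : realType) (T : measurableType dT).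
Context (P : probability T R) (d n : nat).
Variables (f : d.-tuple R -> n.-tuple R) (X : {RV P >-> d.-tuple R}).
Variable Z : forall u : {set 'I_d}, {RV P >-> (d - #|u|).-tuple R}.
Variable r : forall u : {set 'I_d},
  #|u|.-tuple R -> (d - #|u|).-tuple R -> #|~: u|.-tuple R.
Variable u : {set 'I_d}.

Definition gfun (x : #|u|.-tuple R) (z : (d - #|u|).-tuple R) : n.-tuple R :=
  f (join_vec x (r x z)).

Record dependency_model : Prop := {
  dep_meas : measurable_fun setT
    (fun p : #|u|.-tuple R * (d - #|u|).-tuple R => r p.1 p.2) ;
  dep_Z : independent_components P (Z u) ;
  dep_XZ : independent2 P (subvec u \o X) (Z u) ;
  dep_law : same_law P (subvec (~: u) \o X)
                     P (fun w => r (subvec u (X w)) (Z u w)) ;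
  dep_g : same_law P (fun w => gfun (subvec u (X w)) (Z u w)) P (f \o X) }.

(* By independence and Fubini, the partial expectations in gfo and gtot then
   exist for almost every x, resp. z; fine makes them 0 at most on the
   exceptional null set. *)
Definition g_integrable : Prop :=
  forall i : 'I_n, P.-integrable setT
    (fun w => (tnth (gfun (subvec u (X w)) (Z u w)) i)%:E).

(* As X_u and Z are independent, the expectation over Z (resp. X_u) alone is
   taken with the other argument frozen. *)
Definition gfo (x : #|u|.-tuple R) : n.-tuple R :=
  [tuple fine 'E_P[fun w => tnth (gfun x (Z u w)) i]
         - fine 'E_P[fun w => tnth (gfun (subvec u (X w)) (Z u w)) i] | i < n].

Definition gtot (x : #|u|.-tuple R) (z : (d - #|u|).-tuple R) : n.-tuple R :=
  [tuple tnth (gfun x z) i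
         - fine 'E_P[fun w => tnth (gfun (subvec u (X w)) z) i] | i < n].

End anova.

(* u = set0 is allowed: both functionals are then identically 0, whatever
   r set0 and Z set0 are, so that it only contributes the law \d_0. *)
Definition AF_laws (dT : measure_display) (R : realType)
    (T : measurableType dT) (P : probability T R) (d n : nat)
    (f : d.-tuple R -> n.-tuple R) (X : {RV P >-> d.-tuple R})
    (Z : forall u : {set 'I_d}, {RV P >-> (d - #|u|).-tuple R})
    (r : forall u : {set 'I_d},
       #|u|.-tuple R -> (d - #|u|).-tuple R -> #|~: u|.-tuple R) :
    set (probability (n.-tuple R) R) :=
  [set F | exists u : {set 'I_d},
     has_law P (fun w => gtot f X r (subvec u (X w)) (Z u w)) F \/
     has_law P (fun w => gfo f X Z r (subvec u (X w))) F].

(* A real Hilbert space: a complete normed space whose norm comes from an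
   inner product. *)
Definition valid_kernel (R : realType) (S : Type) (k : S -> S -> R) : Prop :=
  exists (V : completeNormedModType R) (ip : {dot V for idfun}) (phi : S -> V),
    (forall v : V, ip v v = `|v| ^+ 2) /\
    (forall s s', k s s' = ip (phi s) (phi s')).

(* The integral against a signed measure, through its Jordan decomposition. *)
Definition charge_integral (dE : measure_display) (R : realType)
    (E : measurableType dE) (nu : {charge set E -> \bar R}) (h : E -> \bar R) :
    \bar R :=
  let PN := projT2 (cid (projT2 (cid (Hahn_decomposition nu)))) in
  (\int[jordan_pos PN]_x h x - \int[jordan_neg PN]_x h x)%E.

Definition charge_diff (dE : measure_display) (R : realType)
    (E : measurableType dE)
    (mu1 mu2 : {finite_measure set E -> \bar R}) : {charge set E -> \bar R} :=
  cadd (charge_of_finite_measure mu1) (copp (charge_of_finite_measure mu2)).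

Definition product_law (dE dE' : measure_display) (R : realType)
    (E : measurableType dE) (E' : measurableType dE')
    (F : probability E R) (F' : probability E' R) :
    probability (E * E')%type R := (F \x F')%E.

Section kernels.
Context (R : realType) (n : nat).
Implicit Type k : n.-tuple R -> n.-tuple R -> R.

Definition is_kernel k : Prop :=
  valid_kernel k /\
  measurable_fun setT (fun p : n.-tuple R * n.-tuple R => k p.1 p.2).

Definition centered0 k : Prop := forall x, k x (zerov R n) = 0.

Definition dirac_law : probability (n.-tuple R) R := \d_(zerov R n).

Definition equivalent_kernel_class (calF : set (probability (n.-tuple R) R)) k :
    Prop :=
  is_kernel k /\
  ((centered0 k /\
    forall F : probability (n.-tuple R) R, calF F ->
      ('E_(product_law F F)[fun p => k p.1 p.2] = 0)%E ->
      forall A, measurable A -> F A = dirac_law A)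
   \/
   (forall F : probability (n.-tuple R) R, calF F ->
      let nu := charge_diff (product_law F F)
                            (product_law dirac_law dirac_law) in
      charge_integral nu (fun p => (k p.1 p.2)%:E) = 0%E ->
      forall A, measurable A -> nu A = 0%E)).

End kernels.

(* Main.v *)
(* Let F be the law of the total functional G; it belongs to the class of laws
   of ANOVA functionals.  The pair of i.i.d. copies of G has law F (x) F, so
   the hypothesis reads E_(F (x) F)[k] = k(0, 0).  In case (a) k(0, 0) = 0, and
   F is the Dirac law at once.  In case (b) Cauchy-Schwarz in the Hilbert space,
   |k(x, y)| <= sqrt k(x, x) * sqrt k(y, y), makes k integrable for F (x) F, so
   that the integral of k against nu = F (x) F - H (x) H is the difference of
   the two integrals, which is 0; then nu = 0, and its marginals give F = H. *)
Require Import Defs.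
From mathcomp Require Import all_boot all_order all_algebra.
From mathcomp Require Import sesquilinear ring.
From mathcomp Require Import all_classical all_reals all_analysis.
From mathcomp Require Import measurable_realfun.

Set Implicit Arguments.
Unset Strict Implicit.
Unset Printing Implicit Defensive.

Import Order.TTheory GRing.Theory Num.Theory.
Import numFieldNormedType.Exports.
Local Open Scope classical_set_scope.
Local Open Scope ring_scope.

(** * Measurability of the total functional *)

Lemma measurable_subvec (R : realType) (d : nat) (u : {set 'I_d}) :
  measurable_fun setT (@subvec R d u).
Proof.
apply/measurable_fun_tnthP => i.
rewrite (_ : _ \o _ = (@tnth _ _)^~ (enum_val i)).
  exact: measurable_tnth.
by apply/funext => x /=; rewrite tnth_mktuple.
Qed.

(** [join_vec] reads entries through [nth]: an index in range gives a projection, any other gives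
    the default 0, hence a constant map. *)
Lemma measurable_nth_tuple (R : realType) (m j : nat) :
  measurable_fun setT (fun x : m.-tuple R => nth 0 x j).
Proof.
have [jm|mj] := ltnP j m; last first.
  rewrite (_ : (fun _ => _) = cst 0); first exact: measurable_cst.
  by apply/funext => x; rewrite nth_default// size_tuple.
rewrite (_ : (fun _ => _) = (@tnth _ _)^~ (Ordinal jm)).
  exact: measurable_tnth.
by apply/funext => x; rewrite (tnth_nth 0).
Qed.

Lemma measurable_join_vec (R : realType) (d : nat) (u : {set 'I_d}) :
  measurable_fun setT
    (fun p : #|u|.-tuple R * #|~: u|.-tuple R => join_vec p.1 p.2).
Proof.
apply/measurable_fun_tnthP => j; rewrite /comp /=.
under eq_fun do rewrite tnth_mktuple.
case: (j \in u).
- exact: (measurableT_comp (@measurable_nth_tuple R #|u| _) measurable_fst).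
- exact: (measurableT_comp (@measurable_nth_tuple R #|~: u| _) measurable_snd).
Qed.

(** Tonelli gives this for nonnegative integrands; splitting [h] into its positive and negative
    parts extends it to every measurable [h]. *)
Lemma measurable_partial_integral d1 d2 (T1 : measurableType d1)
    (T2 : measurableType d2) (R : realType)
    (m : {sigma_finite_measure set T1 -> \bar R}) (h : T1 * T2 -> \bar R) :
  measurable_fun [set: T1 * T2] h ->
  measurable_fun setT (fun y => \int[m]_x h (x, y))%E.
Proof.
move=> mh; under eq_fun do rewrite integralE.
apply: emeasurable_funB.
- have := measurable_fun_fubini_tonelli_G (m1 := m) h^\+%E
    (measurable_funepos mh) (fun=> funepos_ge0 _ _).
  by rewrite /fubini_G funepos.unlock.
- have := measurable_fun_fubini_tonelli_G (m1 := m) h^\-%E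
    (measurable_funeneg mh) (fun=> funeneg_ge0 _ _).
  by rewrite /fubini_G funeneg.unlock.
Qed.

Lemma measurable_gtot dT (R : realType) (T : measurableType dT)
    (P : probability T R) (d n : nat) (f : d.-tuple R -> n.-tuple R)
    (X : {RV P >-> d.-tuple R})
    (r : forall u : {set 'I_d},
       #|u|.-tuple R -> (d - #|u|).-tuple R -> #|~: u|.-tuple R)
    (u : {set 'I_d}) :
  measurable_fun setT f ->
  measurable_fun setT
    (fun p : #|u|.-tuple R * (d - #|u|).-tuple R => r u p.1 p.2) ->
  measurable_fun setT
    (fun p : #|u|.-tuple R * (d - #|u|).-tuple R => gtot f X r p.1 p.2).
Proof.
move=> mf mr.
have mg : measurable_fun setT
    (fun p : #|u|.-tuple R * (d - #|u|).-tuple R => gfun f r p.1 p.2).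
  apply: (measurableT_comp mf).
  apply: (measurableT_comp (@measurable_join_vec R d u)
    (g := fun p => (p.1, r u p.1 p.2))).
  exact: (measurable_fun_pair measurable_fst mr).
have mgi i : measurable_fun setT
    (fun p : #|u|.-tuple R * (d - #|u|).-tuple R =>
      tnth (gfun f r p.1 p.2) i).
  exact: (measurableT_comp (measurable_tnth i) mg).
apply/measurable_fun_tnthP => i; rewrite /comp /=.
under eq_fun do rewrite tnth_mktuple.
apply: measurable_funB; first exact: mgi.
apply: (measurableT_comp (@fine_measurable R setT measurableT)).
rewrite expectation.unlock.
(* The subtracted mean is an integral over the sample point with [z] frozen, so it is a partial
   integral of [h], evaluated at the second component. *)
pose h (p : T * (d - #|u|).-tuple R) : \bar R :=
  (tnth (gfun f r (subvec u (X p.1)) p.2) i)%:E.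
have mh : measurable_fun setT h.
  apply: measurableT_comp => //.
  apply: (measurableT_comp (mgi i) (g := fun p => (subvec u (X p.1), p.2))).
  apply: measurable_fun_pair measurable_snd.
  apply: (measurableT_comp (@measurable_subvec R d u)).
  by apply: measurableT_comp measurable_fst.
exact: (measurableT_comp (measurable_partial_integral P mh) measurable_snd).
Qed.

(** * The Cauchy-Schwarz bound for kernels *)

(** With a and b the norms of [v] and [w], the vectors b v + a w and b v - a w have squared norms
    2ab(ab + c) and 2ab(ab - c), where c = [ip v w]. Both are nonnegative; zero vectors are set
    apart so that 2ab can be cancelled. *)
Lemma dot_abs_le (R : realType) (V : lmodType R) (ip : {dot V for idfun})
    (v w : V) :
  `|ip v w| <= Num.sqrt (ip v v) * Num.sqrt (ip w w).
Proof.
have [->|v0] := eqVneq v 0; first by rewrite !linear0l sqrtr0 mul0r normr0.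
have [->|w0] := eqVneq w 0; first by rewrite !linear0r sqrtr0 mulr0 normr0.
have ge0 x : 0 <= ip x x.
  have [->|x0] := eqVneq x 0; first by rewrite linear0l.
  by rewrite ltW// neq0_dnorm_gt0.
have vw : ip w v = ip v w by rewrite hermC expr0 mul1r.
have Zl s x y : ip (s *: x) y = s * ip x y by rewrite linearZl_LR.
have Zr s x y : ip x (s *: y) = s * ip x y by rewrite linearZr_LR.
have ipE (s t : R) : ip (s *: v + t *: w) (s *: v + t *: w) =
    s ^+ 2 * ip v v + 2 * s * t * ip v w + t ^+ 2 * ip w w.
  rewrite [LHS]linearDl [X in X + _ = _]linearDr [X in _ + X = _]linearDr/=.
  rewrite !(Zl, Zr) vw.
  move: (ip v v) (ip v w) (ip w w) => x y z; ring.
have : 0 < Num.sqrt (ip v v) by rewrite sqrtr_gt0 neq0_dnorm_gt0.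
have : 0 < Num.sqrt (ip w w) by rewrite sqrtr_gt0 neq0_dnorm_gt0.
move: (sqr_sqrtr (ge0 v)) (sqr_sqrtr (ge0 w)).
set a := Num.sqrt _; set b := Num.sqrt _ => aE bE b0 a0.
have ab0 : 0 < 2 * (a * b) by rewrite !mulr_gt0.
have := ge0 (b *: v + a *: w); have := ge0 (b *: v + (- a) *: w).
rewrite !ipE -aE -bE ler_norml.
clearbody a b; move: (ip v w) => {aE bE} c h1 h2.
by apply/andP; split; rewrite -(ler_pM2l ab0) -subr_ge0; [move: h2|move: h1];
  congr (_ <= _); ring.
Qed.

Lemma valid_kernel_abs_le (R : realType) (S : Type) (k : S -> S -> R) s s' :
  valid_kernel k -> `|k s s'| <= Num.sqrt (k s s) * Num.sqrt (k s' s').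
Proof. by move=> [V [ip [phi [_ kE]]]]; rewrite !kE dot_abs_le. Qed.

(** * Change of variables and i.i.d. copies *)

(** For nonnegative functions this is integration against the pushforward measure; applying it to
    both parts of [f] covers non-integrable [f] as well. *)
Lemma integral_law d1 d2 (T1 : measurableType d1) (T2 : measurableType d2)
    (R : realType) (mu : {measure set T1 -> \bar R})
    (m : {measure set T2 -> \bar R}) (phi : T1 -> T2) (f : T2 -> \bar R) :
  measurable_fun setT phi ->
  (forall A, measurable A -> mu (phi @^-1` A) = m A) ->
  measurable_fun setT f ->
  (\int[mu]_x f (phi x) = \int[m]_y f y)%E.
Proof.
move=> mphi law mf.
have ge0_law (h : T2 -> \bar R) : measurable_fun setT h ->
    (forall y, 0 <= h y)%E -> (\int[mu]_x h (phi x) = \int[m]_y h y)%E.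
  move=> mh h0; transitivity (\int[pushforward mu phi]_y h y)%E.
    by rewrite (ge0_integral_pushforward mphi).
  by apply: eq_measure_integral => A mA _; exact: law.
have mfp := measurable_funepos mf; have mfn := measurable_funeneg mf.
rewrite funepos.unlock in mfp; rewrite funeneg.unlock in mfn.
rewrite [LHS]integralE [RHS]integralE funepos.unlock funeneg.unlock.
congr (_ - _)%E.
- by apply: (ge0_law _ mfp) => y; rewrite le_max lexx orbT.
- by apply: (ge0_law _ mfn) => y; rewrite le_max lexx orbT.
Qed.

(** By independence, the law of the pair of images factors on measurable rectangles, and a product
    measure is determined by its values there. [P1] and [P2] are compared only through laws. *)
Lemma expectation_iid_copies d1 d2 dE dS (R : realType)
    (T1 : measurableType d1) (T2 : measurableType d2) (E : measurableType dE)
    (S : measurableType dS) (P1 : probability T1 R) (V : T1 -> E)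
    (P2 : probability T2 R) (V1 V2 : {RV P2 >-> E}) (G : E -> S)
    (F : probability S R) (h : S * S -> R) :
  iid_copies P1 V V1 V2 -> measurable_fun setT G ->
  has_law P1 (G \o V) F -> measurable_fun setT h ->
  ('E_P2[fun w => h (G (V1 w), G (V2 w))] = 'E_(product_law F F)[h])%E.
Proof.
move=> [law1 law2 indep] mG [_ lawF] mh; rewrite expectation.unlock.
have mGV (W : {RV P2 >-> E}) : measurable_fun setT (G \o W).
  by apply: (measurableT_comp mG); exact: measurable_funPT.
have mphi : measurable_fun setT (fun w => (G (V1 w), G (V2 w))).
  exact: (measurable_fun_pair (mGV V1) (mGV V2)).
apply: (integral_law (f := EFin \o h) mphi); last exact: measurableT_comp.
have mGA A : measurable A -> measurable (G @^-1` A).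
  by move=> mA; rewrite -[X in measurable X]setTI; exact: mG.
pose F' : {measure set (S * S) -> \bar R} :=
  distribution P2 (mfun_Sub (mem_set mphi)).
move=> A mA; symmetry; apply: (@product_measure_unique _ _ _ _ _ F F F') => //.
move=> B C mB mC.
transitivity (P1 ((G \o V) @^-1` B) * P1 ((G \o V) @^-1` C))%E; last first.
  by rewrite !lawF.
have := indep _ _ (mGA _ mB) (mGA _ mC).
by rewrite -(law1 _ (mGA _ mB)) -(law2 _ (mGA _ mC)).
Qed.

(** * Integration against a difference of two finite measures *)

(** The Jordan parts are what remains of [mu1] and [mu2] once their common mass [rho] is removed:
    [mu2] is the smaller one on [P], [mu1] on [N]. The integral against [rho] then cancels in the
    difference. *)
Lemma jordan_integral_diff d (T : measurableType d) (R : realType)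
    (mu1 mu2 : {finite_measure set T -> \bar R}) (P N : set T)
    (PN : hahn_decomposition (charge_diff mu1 mu2) P N) (f : T -> \bar R) :
  mu1.-integrable setT f -> mu2.-integrable setT f ->
  (\int[jordan_pos PN]_x f x - \int[jordan_neg PN]_x f x =
   \int[mu1]_x f x - \int[mu2]_x f x)%E.
Proof.
move=> f1 f2; have [[mP _] [mN _] PNT PN0] := PN.
(* Both jordan_pos + rho = mu1 and jordan_neg + rho = mu2. *)
pose rho := measure_add (mrestr mu1 mN) (mrestr mu2 mP).
have fin1 A : measurable A -> mu1 A \is a fin_num by exact: fin_num_measure.
have fin2 A : measurable A -> mu2 A \is a fin_num by exact: fin_num_measure.
have addE (m1 m2 : {measure set T -> \bar R}) A :
    measure_add m1 m2 A = (m1 A + m2 A)%E.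
  exact: measure_addE.
have rhoE A : rho A = (mu1 (A `&` N) + mu2 (A `&` P))%E by exact: measure_addE.
have dec1 A : measurable A -> measure_add (jordan_pos PN) rho A = mu1 A.
  move=> mA; have [mAP mAN] := (measurableI _ _ mA mP, measurableI _ _ mA mN).
  have jpE : jordan_pos PN A = (mu1 (A `&` P) - mu2 (A `&` P))%E.
    by rewrite jordan_posE cjordan_posE /crestr0 mem_set.
  have -> : mu1 A = (mu1 (A `&` P) + mu1 (A `&` N))%E.
    exact: (charge_partition (charge_of_finite_measure mu1)).
  rewrite addE [X in (X + _)%E]jpE [X in (_ + X)%E]rhoE.
  move: (fin1 _ mAP) (fin1 _ mAN) (fin2 _ mAP).
  case: (mu1 (A `&` P)) => [a| |]// _; case: (mu1 (A `&` N)) => [b| |]// _.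
  case: (mu2 (A `&` P)) => [c| |]// _.
  by rewrite -!EFinD; congr EFin; ring.
have dec2 A : measurable A -> measure_add (jordan_neg PN) rho A = mu2 A.
  move=> mA; have [mAP mAN] := (measurableI _ _ mA mP, measurableI _ _ mA mN).
  have jnE : jordan_neg PN A = (- (mu1 (A `&` N) - mu2 (A `&` N)))%E.
    by rewrite jordan_negE cjordan_negE /crestr0 mem_set.
  have -> : mu2 A = (mu2 (A `&` P) + mu2 (A `&` N))%E.
    exact: (charge_partition (charge_of_finite_measure mu2)).
  rewrite addE [X in (X + _)%E]jnE [X in (_ + X)%E]rhoE.
  move: (fin1 _ mAN) (fin2 _ mAP) (fin2 _ mAN).
  case: (mu1 (A `&` N)) => [a| |]// _; case: (mu2 (A `&` P)) => [b| |]// _.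
  case: (mu2 (A `&` N)) => [c| |]// _.
  by rewrite -!EFinD; congr EFin; ring.
(* The integral of [|f|] against each summand is at most that against the sum, so integrability
   passes to both summands. *)
have split_integral (m1 m2 m : {measure set T -> \bar R}) :
    (forall A, measurable A -> measure_add m1 m2 A = m A) ->
    m.-integrable setT f ->
    [/\ m1.-integrable setT f, m2.-integrable setT f &
        (\int[m]_x f x = \int[m1]_x f x + \int[m2]_x f x)%E].
  move=> mE /integrableP[mf fm].
  have : (\int[measure_add m1 m2]_x `|f x| < +oo)%E.
    by rewrite (eq_measure_integral m)// => A mA _; exact: mE.
  rewrite ge0_integral_measure_add//; last exact: measurableT_comp.
  move=> lt.
  have [i1 i2] : m1.-integrable setT f /\ m2.-integrable setT f.
    split; apply/integrableP; split=> //; apply: le_lt_trans lt.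
    - by rewrite leeDl// integral_ge0.
    - by rewrite leeDr// integral_ge0.
  split=> //; rewrite -integral_measure_add//.
  by apply: eq_measure_integral => A mA _; exact/esym/mE.
have [ip ir ->] := split_integral _ _ _ dec1 f1.
have [iq _ ->] := split_integral _ _ _ dec2 f2.
(* Cancelling the integral against [rho] is legitimate because all three integrals are finite. *)
move: (integrable_fin_num measurableT ip) (integrable_fin_num measurableT iq).
move: (integrable_fin_num measurableT ir).
case: (\int[rho]_x f x)%E => [a| |]// _.
case: (\int[jordan_pos PN]_x f x)%E => [b| |]// _.
case: (\int[jordan_neg PN]_x f x)%E => [c| |]// _.
by rewrite -!EFinD; congr EFin; ring.
Qed.

(** * Integrals of the kernel against the two product laws *)

(** The Cauchy-Schwarz bound is a product of functions of separate variables, so by Tonelli its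
    integral is the square of the finite expectation of [Num.sqrt (k x x)]. *)
Lemma integrable_kernel d (S : measurableType d) (R : realType)
    (F : probability S R) (k : S -> S -> R) :
  valid_kernel k -> measurable_fun setT (fun p : S * S => k p.1 p.2) ->
  ('E_F[fun x => Num.sqrt (k x x)] < +oo)%E ->
  (product_law F F).-integrable setT (fun p => (k p.1 p.2)%:E).
Proof.
move=> vk mk kF; rewrite expectation.unlock in kF.
have ms : measurable_fun setT (fun x => Num.sqrt (k x x)).
  have msqrt : measurable_fun setT (@Num.sqrt R).
    by apply: continuous_measurable_fun; exact: sqrt_continuous.
  apply: (measurableT_comp msqrt).
  apply: (measurableT_comp mk (g := fun x => (x, x))).
  exact: measurable_fun_pair.
pose g (p : S * S) := (Num.sqrt (k p.1 p.1) * Num.sqrt (k p.2 p.2))%:E.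
have g0 p : (0 <= g p)%E by rewrite lee_fin mulr_ge0// sqrtr_ge0.
have mg : measurable_fun setT g.
  apply: measurableT_comp => //; apply: measurable_funM.
  - exact: (measurableT_comp ms measurable_fst).
  - exact: (measurableT_comp ms measurable_snd).
apply: (@le_integrable _ _ _ _ _ measurableT _ g) => //.
- exact: measurableT_comp.
- by move=> p _; rewrite (gee0_abs (g0 p)) lee_fin valid_kernel_abs_le.
apply/integrableP; split => //.
under eq_integral do rewrite gee0_abs//.
have -> : (\int[product_law F F]_p g p = \int[F]_x fubini_F F g x)%E.
  exact: fubini_tonelli1.
set I := (\int[F]_x _)%E in kF.
have I0 : (0 <= I)%E by apply: integral_ge0 => x _; rewrite lee_fin sqrtr_ge0.
have -> : (\int[F]_x fubini_F F g x = I * I)%E.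
  transitivity (\int[F]_x ((Num.sqrt (k x x))%:E * I))%E.
    apply: eq_integral => x _; rewrite /fubini_F /g /=.
    under eq_integral do rewrite EFinM.
    by rewrite ge0_integralZl//; exact: measurableT_comp.
  by rewrite ge0_integralZr//; exact: measurableT_comp.
by rewrite lte_mul_pinfty// ge0_fin_numE.
Qed.

(** The product of two Dirac measures at [a] is the Dirac measure at [(a, a)], since they agree on
    rectangles. *)
Lemma integral_dirac2 d (S : measurableType d) (R : realType) (a : S)
    (h : S * S -> \bar R) :
  measurable_fun setT h ->
  (\int[product_law (\d_a : probability S R) (\d_a : probability S R)]_p h p =
   h (a, a))%E.
Proof.
move=> mh; transitivity (\int[\d_(a, a)]_p h p)%E; last first.
  by rewrite (integral_dirac _ _ mh)// diracT mul1e.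
apply: eq_measure_integral => A mA _.
apply: (@product_measure_unique _ _ _ _ _ (\d_a : probability S R)
  (\d_a : probability S R) (\d_(a, a))) => // B C mB mC.
by rewrite /= /dirac !indicE -EFinM -natrM mulnb in_setX.
Qed.

(** * From the law of the total functional to almost sure vanishing *)

Lemma measurable_set1_tuple (R : realType) (n : nat) (x : n.-tuple R) :
  measurable [set x].
Proof.
have -> : [set x] = \bigcap_(i in [set: 'I_n])
    ((fun y : n.-tuple R => tnth y i) @^-1` [set tnth x i]).
  apply/seteqP; split => [y -> //|y xy].
  by apply: eq_from_tnth => i; exact: xy.
apply: fin_bigcap_measurable => // i _; rewrite -[X in measurable X]setTI.
by apply: measurable_tnth => //; exact: measurable_set1.
Qed.

Theorem lemma2 (dT : measure_display) (R : realType) (T : measurableType dT)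
    (P : probability T R) (d n : nat)
    (f : d.-tuple R -> n.-tuple R) (X : {RV P >-> d.-tuple R})
    (Z : forall u : {set 'I_d}, {RV P >-> (d - #|u|).-tuple R})
    (r : forall u : {set 'I_d},
       #|u|.-tuple R -> (d - #|u|).-tuple R -> #|~: u|.-tuple R)
    (mf : measurable_fun setT f)
    (model : forall u : {set 'I_d}, u != finset.set0 ->
       dependency_model f X Z r u)
    (g_int : forall u : {set 'I_d}, u != finset.set0 -> g_integrable f X Z r u)
    (k : n.-tuple R -> n.-tuple R -> R)
    (kE : equivalent_kernel_class (AF_laws f X Z r) k)
    (k_int : forall F : probability (n.-tuple R) R, AF_laws f X Z r F ->
       ('E_F[fun x => Num.sqrt (k x x)] < +oo)%E)
    (u : {set 'I_d}) (u_neq0 : u != finset.set0)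
    (dT2 : measure_display) (T2 : measurableType dT2) (P2 : probability T2 R)
    (V V' : {RV P2 >-> (#|u|.-tuple R * (d - #|u|).-tuple R)%type})
    (VV' : iid_copies P (fun w => (subvec u (X w), Z u w)) V V') :
  ('E_P2[fun w => k (gtot f X r (V w).1 (V w).2) (gtot f X r (V' w).1 (V' w).2)]
     - (k (zerov R n) (zerov R n))%:E = 0)%E ->
  {ae P, forall w, gtot f X r (subvec u (X w)) (Z u w) = zerov R n}.
Proof.
have mG := measurable_gtot X mf (dep_meas (model _ u_neq0)).
set G := (fun p => _) in mG.
set W := (fun w => (subvec u (X w), Z u w)) in VV'.
have mW : measurable_fun setT W.
  apply: measurable_fun_pair => //.
  exact: (measurableT_comp (@measurable_subvec R d u)).
have mGW : measurable_fun setT (G \o W) by exact: measurableT_comp.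
pose F : probability (n.-tuple R) R := distribution P (mfun_Sub (mem_set mGW)).
have lawF : has_law P (G \o W) F by [].
have AF : AF_laws f X Z r F by exists u; left.
have [[vk mk] kcases] := kE.
rewrite (expectation_iid_copies VV' mG lawF mk) => Ek.
have kF := integrable_kernel vk mk (k_int _ AF).
(* A Dirac law at 0 gives no mass to the complement of 0, whose preimage under [G \o W] is the
   required null set. *)
suff FD A : measurable A -> F A = dirac_law R n A.
  have m0 : measurable (~` [set zerov R n]).
    by apply: measurableC; exact: measurable_set1_tuple.
  exists ((G \o W) @^-1` (~` [set zerov R n])); split.
  - by rewrite -[X in measurable X]setTI; exact: (mGW measurableT _ m0).
  - transitivity (dirac_law R n (~` [set zerov R n])); first exact: FD.
    by rewrite /dirac_law /= /dirac indicE memNset //=; apply.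
  - by [].
case: kcases => [[k0 inj]|inj].
  by apply: inj => //; rewrite k0 sube0 in Ek.
move=> mA.
have mEk : measurable_fun setT
    (fun p : n.-tuple R * n.-tuple R => (k p.1 p.2)%:E).
  exact: measurableT_comp.
have nuk : charge_integral
    (charge_diff (product_law F F)
      (product_law (dirac_law R n) (dirac_law R n)))
    (fun p => (k p.1 p.2)%:E) = 0%E.
  rewrite /charge_integral jordan_integral_diff//.
    by rewrite integral_dirac2// -Ek expectation.unlock.
  (* Against the Dirac product, the integral of the absolute value of [k] is its value at the
     origin, hence finite. *)
  apply/integrableP; split=> //.
  rewrite (@integral_dirac2 _ _ _ _ (fun p => `|(k p.1 p.2)%:E|%E)) ?ltry//.
  exact: measurableT_comp.
have marginal (Q : probability (n.-tuple R) R) :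
    product_law Q Q (A `*` setT) = Q A.
  transitivity (Q A * Q setT)%E; first exact: product_measure1E.
  by rewrite probability_setT mule1.
(* Testing the vanishing charge on a cylinder over [A] compares the first marginals, that is, [F A]
   with the Dirac mass of [A]. *)
have : (product_law F F (A `*` setT) -
    product_law (dirac_law R n) (dirac_law R n) (A `*` setT) = 0)%E.
  exact: (inj _ AF nuk _ (measurableX mA measurableT)).
rewrite !marginal => /eqP.
rewrite sube_eq ?fin_num_adde_defl ?fin_num_measure//.
by rewrite add0e => /eqP.
Qed.
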